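(* Let $M = (m_{i,j})$ be a $q \times k$ row-stochastic matrix, where $q \ge 3$ and $2\le k \le q$ are integers. Let $c_q = \frac{(q-1)^3}{q(q-2)} \log(q-1)$. Then, for any real $c < \frac{k-1}{q-1}\, c_q$, \[ \frac{1}{q} h(M) + c\log\left(kq - k - q + \frac{k}{q}\, \rho(M) \right) \leq \log k + c\log\left((q-1)(k-1)\right), \] or, equivalently, \[ c\log\left(1+\frac{\frac{k}{q}\rho(M)-1}{(q-1)(k-1)}\right) \leq \log k - \frac{1}{q} h(M), \] with equality if and only if $m_{i,j} = \frac{1}{k}$ for all $i\in[q]$, $j\in[k]$.
   Context: A matrix is row-stochastic if all its entries are nonnegative real numbers and the entries of each row sum to $1$. For a $q\times k$ matrix $M=(m_{i,j})$ with nonnegative entries, $\rho(M) = \sum_{i=1}^q \sum_{j=1}^k m_{i,j}^2$ and $h(M) = - \sum_{i=1}^q \sum_{j=1}^k m_{i,j}\log m_{i,j}$, with the convention $0\log 0=0$. $\log$ is the natural logarithm. *)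

(* Defs.v *)
From mathcomp Require Import all_boot all_order all_algebra.
From mathcomp Require Import reals exp.

Set Implicit Arguments.
Unset Strict Implicit.
Unset Printing Implicit Defensive.

Import Order.TTheory GRing.Theory Num.Theory.
Local Open Scope ring_scope.

Definition row_stochastic (R : realType) (q k : nat) (M : 'M[R]_(q, k)) : Prop :=
  (forall i j, 0 <= M i j) /\ (forall i, \sum_(j < k) M i j = 1).

Definition rho (R : realType) (q k : nat) (M : 'M[R]_(q, k)) : R :=
  \sum_(i < q) \sum_(j < k) M i j ^+ 2.

(* The convention 0 log 0 = 0 holds because [ln] is total. *)
Definition entropy (R : realType) (q k : nat) (M : 'M[R]_(q, k)) : R :=
  - \sum_(i < q) \sum_(j < k) M i j * ln (M i j).

Definition c_crit (R : realType) (q : nat) : R :=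
  (q%:R - 1) ^+ 3 / (q%:R * (q%:R - 2)) * ln (q%:R - 1).

(* Main.v *)
Require Import Defs.
From mathcomp Require Import all_boot all_order all_algebra.
From mathcomp Require Import reals exp.
From mathcomp Require Import topology normedtype derive realfun.
From mathcomp Require Import zify ring lra.

(* With X = (k/q) rho(M) - 1, log (1 + x) <= x reduces the claim to the row-wise
   bound  KL(p || uniform) >= g (k |p|^2 - 1)  with g = y log y / (y^2 - 1) at
   y = q - 1; the strict bound on c gives the equality case.  Since
   y log y / (y^2 - 1) decreases in y, g may be replaced by its value at any
   y <= q - 1, and the row-wise bound follows by induction on the size of the
   support: split off a coordinate of at least average mass and use the chain
   rule of relative entropy.  The two-point part of the chain rule is the
   Kearns-Saul inequality
     KL(Bernoulli(x) || Bernoulli(p)) >= log((1-p)/p) / (1-2p) * (x-p)^2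
   at p = 1/(n+1), and the monotonicity of g makes the constants match. *)

Set Implicit Arguments.
Unset Strict Implicit.
Unset Printing Implicit Defensive.

Import Order.TTheory GRing.Theory Num.Theory.
Import numFieldNormedType.Exports.
Local Open Scope ring_scope.

(** * Monotonicity from derivatives and elementary bounds on the logarithm *)

Lemma MVT_itvcc (R : realType) (f df : R -> R) (a b : R) : a < b ->
  (forall x, a <= x <= b -> is_derive x 1 f (df x)) ->
  exists2 c, a < c < b & f b - f a = df c * (b - a).
Proof.
move=> ab fdf.
have [x||c] := MVT (f := f) (df := df) ab.
- by rewrite in_itv /= => /andP[/ltW ax /ltW xb]; apply: fdf; rewrite ax.
- apply: derivable_within_continuous => x; rewrite in_itv /= => xab.
  by have [] := fdf x xab.
- by rewrite in_itv /= => cab; exists c.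
Qed.

Lemma derive_ge0_homo (R : realType) (f df : R -> R) (a b : R) : a <= b ->
  (forall x, a <= x <= b -> is_derive x 1 f (df x)) ->
  (forall x, a < x < b -> 0 <= df x) -> f a <= f b.
Proof.
rewrite le_eqVlt => /predU1P[-> //|ab] fdf df0.
have [c cab fE] := MVT_itvcc ab fdf.
by rewrite -subr_ge0 fE mulr_ge0 ?df0// subr_ge0 ltW.
Qed.

(** The gap vanishes at 1 and has derivative [ln x + x^-1 - 1], nonnegative because
    [ln x^-1 <= x^-1 - 1]. *)
Lemma ler_ln_pade (R : realType) (z : R) : 1 <= z ->
  2 * (z - 1) <= ln z * (z + 1).
Proof.
move=> z1.
have d x : 1 <= x <= z -> is_derive x 1 (fun y : R => ln y * (y + 1) - (2 * (y - 1)))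
    (ln x + x^-1 - 1).
  move=> /andP[x1 _]; have x0 : 0 < x by lra.
  have h := is_derive1_ln x0.
  apply: is_derive_eq.
  by rewrite /GRing.scale/=; field; lra.
have := derive_ge0_homo z1 d.
rewrite ln1 => H.
have {}H : 0 * (1 + 1) - 2 * (1 - 1) <= ln z * (z + 1) - 2 * (z - 1) :> R.
  apply: H => x /andP[x1 _].
  have x0 : 0 < x by lra.
  have := le_ln1Dx (x := x^-1 - 1); rewrite [1 + _]addrC subrK lnV ?posrE//.
  have : 0 < x^-1 by rewrite invr_gt0.
  by move=> ? /(_ ltac:(lra)); lra.
lra.
Qed.

(** With z = e^t this is t <= sinh t; it gives the sign of the derivative in [ln_slope_homo]. *)
Lemma ler_ln_sinh (R : realType) (z : R) : 1 <= z ->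
  2 * z * ln z <= z ^+ 2 - 1.
Proof.
move=> z1.
have d x : 1 <= x <= z -> is_derive x 1 (fun y : R => y ^+ 2 - 1 - (2 * y * ln y))
    (2 * (x - 1 - ln x)).
  move=> /andP[x1 _]; have x0 : 0 < x by lra.
  have h := is_derive1_ln x0.
  apply: is_derive_eq.
  by rewrite /GRing.scale/=; field; lra.
have := derive_ge0_homo z1 d.
rewrite ln1 => H.
have {}H : 1 ^+ 2 - 1 - 2 * 1 * 0 <= z ^+ 2 - 1 - 2 * z * ln z :> R.
  apply: H => x /andP[x1 _].
  have := le_ln1Dx (x := x - 1); rewrite [1 + _]addrC subrK.
  by move=> /(_ ltac:(lra)); lra.
lra.
Qed.

(** Amounts to [kl_const R 2 <= kl_const R 1]; it holds since (9/8)^6 > 2 and ln (9/8) <= 1/8. *)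
Lemma ln2_le34 (R : realType) : ln 2 <= 3 / 4 :> R.
Proof.
have : ln (2 : R) <= ln ((9 / 8) ^+ 6).
  by rewrite ler_ln ?posrE ?exprn_gt0//; lra.
rewrite lnXn; last by lra.
have := le_ln1Dx (x := 8^-1 : R) ltac:(lra).
rewrite (_ : 1 + 8^-1 = 9 / 8); last by field.
rewrite -mulr_natr; lra.
Qed.

(** In the odds z = t/(1-t) this function is the logit of t divided by 2t - 1. For n >= 2 its
    monotonicity supplies both slope hypotheses of [binary_entropy_tangent]. *)
Lemma ln_slope_homo (R : realType) (y z : R) : 1 < y -> y <= z ->
  ln y * (y + 1) / (y - 1) <= ln z * (z + 1) / (z - 1).
Proof.
move=> y1 yz.
have d x : y <= x <= z ->
    is_derive x 1 (fun t : R => ln t * (t + 1) * (t + - 1)^-1)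
      ((x ^+ 2 - 1 - 2 * x * ln x) / (x * (x - 1) ^+ 2)).
  move=> /andP[yx _]; have x0 : 0 < x by lra.
  have h := is_derive1_ln x0.
  have x1 : x - 1 != 0 by lra.
  have h2 : is_derive x 1 (fun t : R => (t + - 1)^-1) (- (x - 1) ^- 2 *: 1).
    apply: is_deriveV => //; apply: is_derive_eq; by rewrite ?subr0 ?addr0.
  apply: is_derive_eq.
  by rewrite /GRing.scale/=; field; lra.
apply: (derive_ge0_homo yz d) => x /andP[yx _].
apply: divr_ge0; last by rewrite mulr_ge0 ?sqr_ge0//; lra.
by rewrite subr_ge0 ler_ln_sinh//; lra.
Qed.

(** * Tangent bounds for the binary entropy *)

Lemma logit_slopeE (R : realType) (t : R) : 2^-1 < t < 1 ->
  let z := t / (1 - t) in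
  ln z * (z + 1) / (z - 1) = (ln t - ln (1 - t)) / (2 * t - 1).
Proof.
move=> /andP[t2 t1] z; rewrite /z ln_div ?posrE; [|lra..].
by field; lra.
Qed.

(* The left-hand side is, as a function of (x - 1/2)^2, the tangent line to the
   negative binary entropy at x0 when beta is the logit slope at x0. *)
Lemma binary_entropy_tangent (R : realType) (x0 beta x : R) :
  2^-1 <= x0 < 1 ->
  (forall t, 2^-1 < t < x0 -> ln t - ln (1 - t) <= beta * (2 * t - 1)) ->
  (forall t, x0 < t < 1 -> beta * (2 * t - 1) <= ln t - ln (1 - t)) ->
  0 < x < 1 ->
  x0 * ln x0 + (1 - x0) * ln (1 - x0)
    + beta * ((x - 2^-1) ^+ 2 - (x0 - 2^-1) ^+ 2)
  <= x * ln x + (1 - x) * ln (1 - x).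
Proof.
move=> /andP[x02 x01] hl hr.
(* Both sides are invariant under x -> 1 - x. *)
wlog x2 : x / 2^-1 <= x => [hwlog|].
  case: (lerP 2^-1 x) => x2; first exact: hwlog.
  move=> x01'; have := hwlog (1 - x) ltac:(lra) ltac:(lra).
  by rewrite (_ : 1 - (1 - x) = x); [nra|ring].
move=> /andP[_ x1].
(* By [hl] and [hr], [dH] is nonpositive between 1/2 and [x0] and nonnegative beyond, so [x0]
   minimises [H] on [1/2, 1). *)
pose H (t : R) := t * ln t + (1 - t) * ln (1 - t) - beta * (t - 2^-1) ^+ 2.
pose dH (t : R) := ln t - ln (1 - t) - beta * (2 * t - 1).
have dHP (t : R) : 0 < t -> t < 1 -> is_derive t 1 H (dH t).
  move=> t0 t1; have h := is_derive1_ln t0.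
  have t1' : 0 < 1 - t by lra.
  have h1 := is_derive1_ln t1'.
  have h2 : is_derive t 1 (fun y : R => 1 - y) (-1).
    by apply: is_derive_eq; rewrite /GRing.scale/=; ring.
  have h3 := @is_derive1_comp R (@ln R) (fun y => 1 - y) t _ _ h1 h2.
  rewrite /H /dH.
  apply: is_derive_eq; rewrite /GRing.scale/= /comp/=.
  by field; lra.
suff : H x0 <= H x by rewrite /H; lra.
case: (ltgtP x x0) => [xx0|x0x|-> //].
- have [|c /andP[xc cx0]] := @MVT_itvcc R H dH x x0 xx0.
    by move=> t /andP[? ?]; apply: dHP; lra.
  have := hl c ltac:(lra); rewrite -subr_le0 -/(dH c) => dHc.
  have : 0 < x0 - x by lra.
  by move=> ? ?; nra.
- have [|c /andP[xc cx0]] := @MVT_itvcc R H dH x0 x x0x.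
    by move=> t /andP[? ?]; apply: dHP; lra.
  have := hr c ltac:(lra); rewrite -subr_ge0 -/(dH c) => dHc.
  have : 0 < x - x0 by lra.
  by move=> ? ?; nra.
Qed.

(** * The constants g and the two-point inequality *)

(* The value 1/2 at n = 1 is the limit of y ln y / (y^2 - 1) as y tends to 1. *)
Definition kl_const (R : realType) (n : nat) : R :=
  if (n <= 1)%N then 2^-1 else n%:R * ln n%:R / (n%:R ^+ 2 - 1).

Lemma kl_const_ge0 (R : realType) (n : nat) : 0 <= kl_const R n.
Proof.
rewrite /kl_const; case: leqP => [_|n1]; first by rewrite invr_ge0.
have n1' : (1 : R) < n%:R by rewrite ltr1n.
by rewrite divr_ge0 ?mulr_ge0 ?ln_ge0//; nra.
Qed.

Lemma kl_constS (R : realType) (n : nat) : (0 < n)%N ->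
  kl_const R n.+1 <= kl_const R n.
Proof.
rewrite /kl_const; case: n => [//|[_|n _]] /=.
  have := ln2_le34 R; rewrite (_ : 2%:R ^+ 2 - 1 = 3); last by ring.
  lra.
set m := n.+2; rewrite -[m.+1%:R]natr1.
have m2 : (2 : R) <= m%:R by rewrite ler_nat.
move: (m%:R : R) m2 => {n}m m2.
have L0 := ler_ln_pade (z := m) ltac:(lra).
have mV0 : 0 < m^-1 by rewrite invr_gt0; lra.
have L1 := le_ln1Dx (x := m^-1) ltac:(lra).
have lnS : ln (m + 1) = ln m + ln (1 + m^-1).
  by rewrite -lnM ?posrE ?addr_gt0//; [congr ln; field|]; lra.
have mL1 : m * ln (1 + m^-1) <= 1.
  by rewrite -ler_pdivlMl ?mulr1; lra.
rewrite lnS; move: (ln m) (ln (1 + _)) L0 mL1 {L1 lnS} => L D L0 mD.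
rewrite ler_pdivlMr; last by nra.
rewrite mulrAC ler_pdivrMr; last by nra.
suff : (m + 1) ^+ 2 * (m - 1) * (m * D) <= (m ^+ 2 + m + 1) * (m * L) by nra.
have p1 : 0 <= (m + 1) ^+ 2 * (m - 1) by rewrite mulr_ge0 ?sqr_ge0//; lra.
apply: (le_trans (ler_wpM2l p1 mD)).
rewrite mulr1 -(ler_pM2r (_ : 0 < m + 1)); last by lra.
have p2 : 0 <= (m ^+ 2 + m + 1) * m by rewrite mulr_ge0//; nra.
rewrite mulrA -[leRHS]mulrA; apply: (le_trans _ (ler_wpM2l p2 L0)).
(* The inner factor m^3 - m^2 - m - 1 is positive from m = 2 on but negative at m = 1, which is why
   the step from 1 to 2 rests on [ln2_le34]. *)
rewrite -subr_ge0 (_ : _ - _ = (m - 1) * (m * (m * (m - 1) - 1) - 1)); last by ring.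
by rewrite mulr_ge0//; nra.
Qed.

Lemma kl_const_antitone (R : realType) (m n : nat) : (0 < m)%N -> (m <= n)%N ->
  kl_const R n <= kl_const R m.
Proof.
move=> m0 /subnKC <-; elim: (n - m)%N => [|d IH]; first by rewrite addn0.
by rewrite addnS; apply: le_trans IH; rewrite kl_constS// addn_gt0 m0.
Qed.

(** The endpoint x = 0 of [bernoulli_kl_ge], to which x = 1 also reduces; the tangent argument
    covers only 0 < x < 1. The chain is [kl_const R n] <= n/(n+1) <= 2n/(2n+1) <= n ln (1 + 1/n). *)
Lemma kl_const_le_lnS (R : realType) (n : nat) : (0 < n)%N ->
  kl_const R n <= n%:R * (ln n.+1%:R - ln n%:R).
Proof.
move=> n0.
have n1 : (1 : R) <= n%:R by rewrite ler1n.
have -> : ln n.+1%:R - ln n%:R = ln (1 + n%:R^-1) :> R.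
  rewrite -ln_div ?posrE ?ltr0n// -natr1; congr ln; field; lra.
have nV0 : 0 < n%:R^-1 :> R by rewrite invr_gt0; lra.
have := ler_ln_pade (z := 1 + n%:R^-1 : R) ltac:(lra).
rewrite addrAC subrr add0r => P.
have {P}P : 2 * n%:R <= n%:R * ln (1 + n%:R^-1) * (2 * n%:R + 1) :> R.
  have := ler_wpM2l (_ : 0 <= n%:R ^+ 2 :> R) P; rewrite sqr_ge0 => /(_ isT).
  rewrite (_ : _ * (2 * _) = 2 * n%:R); last by field; lra.
  by rewrite (_ : n%:R ^+ 2 * _ = n%:R * ln (1 + n%:R^-1) * (2 * n%:R + 1)); last by field; lra.
move: (n%:R * ln _) P => D P.
rewrite /kl_const; case: ltnP => n2; last first.
  by move: P; rewrite (_ : n = 1%N) /=; [lra|lia].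
have n2' : (2 : R) <= n%:R by rewrite ler_nat.
have := le_ln1Dx (x := n%:R - 1 : R) ltac:(lra).
rewrite [1 + _]addrC subrK.
move: (n%:R : R) (ln _) n1 n2' P {nV0} => m L n1 n2' P Lm.
rewrite ler_pdivrMr; last by nra.
rewrite -(ler_pM2r (_ : 0 < 2 * m + 1)); last by lra.
rewrite mulrAC [leRHS]mulrAC.
have q0 : 0 <= m ^+ 2 - 1 by nra.
apply: (le_trans _ (ler_wpM2r q0 P)).
nra.
Qed.

(* Kearns-Saul: the bound is symmetric about x = 1/2 and tight at x = 1/(n+1)
   and x = n/(n+1), hence the tangent point n/(n+1) in the proof. *)
Lemma bernoulli_kl_ge (R : realType) (n : nat) (x : R) : (0 < n)%N ->
  0 <= x <= 1 ->
  kl_const R n * (n.+1%:R * x - 1) ^+ 2 / n%:R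
  <= x * ln x + (1 - x) * ln (1 - x) - (1 - x) * ln n%:R + ln n.+1%:R.
Proof.
move=> n0 /andP[x0 x1].
have n1 : (1 : R) <= n%:R by rewrite ler1n.
have K := kl_const_le_lnS R n0.
have [->|xn0] := eqVneq x 0.
  rewrite mul0r subr0 ln1 mulr0 !add0r mul1r sub0r sqrrN expr1n mulr1.
  rewrite ler_pdivrMr; last by lra.
  by lra.
have [->|xn1] := eqVneq x 1.
  rewrite subrr !mul0r ln1 mulr0 add0r subr0 add0r mulr1.
  rewrite -{1}natr1 addrK.
  rewrite expr2 mulrA mulfK; last by lra.
  move: K; rewrite /kl_const; case: ltnP => n2 K.
    have n2' : (2 : R) <= n%:R by rewrite ler_nat.
    move: K; set A := ln n.+1%:R; set B := ln n%:R => K.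
    (* For g = [kl_const R n] one has g n - g/n = ln n, which turns the case x = 1 into the case x =
       0. *)
    have E : n%:R * B / (n%:R ^+ 2 - 1) * n%:R
             = B + n%:R * B / (n%:R ^+ 2 - 1) / n%:R.
      by field; nra.
    rewrite E -lerBrDl ler_pdivrMr; last by lra.
    by rewrite [leRHS]mulrC.
  move: K; rewrite (_ : n = 1%N) /=; [|lia].
  by rewrite ln1; lra.
have {x0 xn0}x0 : 0 < x by rewrite lt_def xn0.
have {x1 xn1}x1 : x < 1 by rewrite lt_def eq_sym xn1.
clear K.
case: (ltnP 1 n) => n2; last first.
  rewrite /kl_const n2 (_ : n = 1%N) /=; [|lia].
  (* At n = 1 the tangent point is 1/2, where the logit slope has limit 2; the slope condition on
     the left is then vacuous. *)
  have hr t : 2^-1 < t < 1 -> 2 * (2 * t - 1) <= ln t - ln (1 - t) :> R.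
    move=> tt; have := logit_slopeE tt; move: tt => /andP[t2 t1] /= E.
    have z1 : 1 < t / (1 - t) by rewrite ltr_pdivlMr; lra.
    have := ler_ln_pade (ltW z1).
    rewrite -ler_pdivlMr ?subr_gt0 // E.
    by rewrite ler_pdivlMr//; lra.
  have := @binary_entropy_tangent R 2^-1 2 x ltac:(lra) ltac:(move=> ?; lra) hr ltac:(lra).
  rewrite ln1 (_ : 1 - 2^-1 = 2^-1) ?lnV ?posrE//; last by field.
  lra.
have n2' : (2 : R) <= n%:R by rewrite ler_nat.
rewrite /kl_const leqNgt n2 /= -natr1.
move: (n%:R : R) n2' {n1} => m m2.
(* The logit slope at the tangent point m/(m+1), whose odds equal m. *)
pose b := ln m * (m + 1) / (m - 1).
have hl t : 2^-1 < t < m / (m + 1) -> ln t - ln (1 - t) <= b * (2 * t - 1).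
  move=> /andP[t2]; rewrite ltr_pdivlMr => [tm|]; last by lra.
  have t1 : 2^-1 < t < 1 by rewrite t2 /=; nra.
  have /= E := logit_slopeE t1; move: t1 => /andP[_ t1].
  have z1 : 1 < t / (1 - t) by rewrite ltr_pdivlMr; lra.
  have zm : t / (1 - t) <= m by rewrite ler_pdivrMr; nra.
  have := ln_slope_homo z1 zm.
  by rewrite E ler_pdivrMr//; lra.
have hr t : m / (m + 1) < t < 1 -> b * (2 * t - 1) <= ln t - ln (1 - t).
  move=> /andP[]; rewrite ltr_pdivrMr => [tm t1|]; last by lra.
  have t2 : 2^-1 < t by nra.
  have /= E := logit_slopeE (t := t) ltac:(lra).
  have m1 : 1 < m by lra.
  have zm : m <= t / (1 - t) by rewrite ler_pdivlMr; nra.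
  have := ln_slope_homo m1 zm.
  by rewrite E ler_pdivlMr//; lra.
have m01 : 2^-1 <= m / (m + 1) < 1.
  by rewrite ler_pdivlMr ?ltr_pdivrMr; lra.
have := @binary_entropy_tangent R (m / (m + 1)) b x m01 hl hr ltac:(lra).
rewrite (_ : 1 - m / (m + 1) = (m + 1)^-1); last by field; lra.
rewrite ln_div ?posrE ?lnV ?posrE; [|lra..].
set L := ln m; set D := ln (m + 1); set LHS := (X in X <= _) => h.
rewrite -lerBlDr lerBrDr; apply: le_trans h.
(* The tangent bound is exactly the wanted square plus the terms affine in x, so equality holds. *)
rewrite le_eqVlt; apply/orP; left; apply/eqP.
rewrite /LHS /b -/L; field; nra.
Qed.

(** * Relative entropy to the uniform distribution, by induction on the support *)

Lemma sqr_sum_le (R : realType) (I : finType) (A : {set I}) (f : I -> R) :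
  (\sum_(i in A) f i) ^+ 2 <= #|A|%:R * \sum_(i in A) f i ^+ 2.
Proof.
set S := \sum_(i in A) f i; set Q := \sum_(i in A) f i ^+ 2.
have [/eqP|A0] := posnP #|A|.
  by rewrite cards_eq0 => /eqP A0; rewrite /S A0 big_set0 cards0 expr0n mul0r.
rewrite -subr_ge0 -(pmulr_rge0 _ (_ : 0 < #|A|%:R)) ?ltr0n//.
(* Multiplied by #|A|, the Cauchy-Schwarz gap is a sum of squares. *)
have -> : #|A|%:R * (#|A|%:R * Q - S ^+ 2)
    = \sum_(i in A) (#|A|%:R * f i - S) ^+ 2.
  under eq_bigr => i _ do rewrite sqrrB exprMn.
  rewrite big_split sumrB/= sumr_const sumrMnl -mulr_suml -!mulr_sumr -/S -/Q.
  by rewrite -mulr_natl; ring.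
by apply: sumr_ge0 => i _; exact: sqr_ge0.
Qed.

Lemma exists_ge_mean (R : realType) (I : finType) (A : {set I}) (f : I -> R) :
  (0 < #|A|)%N -> exists2 i, i \in A & \sum_(j in A) f j <= #|A|%:R * f i.
Proof.
move=> /card_gt0P[i0 i0A]; case: (Order.TotalTheory.arg_maxP f i0A) => i iA fi.
exists i => //; rewrite mulr_natl -sumr_const; exact: ler_sum.
Qed.

(** The row-wise bound for p = f / S, multiplied by S^2: in this homogeneous form a coordinate can
    be removed without renormalising the rest. *)
Lemma entropy_sum_ge (R : realType) (I : finType) (A : {set I}) (f : I -> R) (g : R) :
  0 <= g -> (forall n, (0 < n < #|A|)%N -> g <= kl_const R n) ->
  (forall i, 0 <= f i) ->
  let S := \sum_(i in A) f i in
  g * (#|A|%:R * \sum_(i in A) f i ^+ 2 - S ^+ 2)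
  <= S * (\sum_(i in A) f i * ln (f i) - S * ln S + S * ln #|A|%:R).
Proof.
move=> g0 + f0; move Em: #|A| => m; elim: m A Em => [|n IH] A Am gle /=.
  have -> : A = set0 by apply/eqP; rewrite -cards_eq0 Am.
  by rewrite !big_set0 expr0n !mul0r subr0 mulr0.
have [|i iA] := @exists_ge_mean R I A f; first by rewrite Am.
rewrite Am !(big_setD1 i iA)/=.
have An : #|A :\ i| = n by move: Am; rewrite (cardsD1 i) iA => -[].
have gle' k : (0 < k < n)%N -> g <= kl_const R k.
  by move=> /andP[k0 kn]; rewrite gle// k0 ltnW.
have /= {IH} := IH _ An gle'.
have := sqr_sum_le (A :\ i) f; rewrite An.
have S'0 : 0 <= \sum_(j in A :\ i) f j by exact: sumr_ge0.
have a0 := f0 i.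
case: (posnP n) => [n0|n0].
  move: An; rewrite n0 => /eqP; rewrite cards_eq0 => /eqP->.
  rewrite !big_set0 !addr0 => _ _ _.
  by rewrite ln1 mulr0 addr0 subrr mulr0 mul1r subrr mulr0.
have gn : g <= kl_const R n by rewrite gle// n0 ltnSn.
have n1 : (1 : R) <= n%:R by rewrite ler1n.
(* If all mass sits at [i], the remainder cannot be normalised; the two-point inequality at x = 1
   suffices. *)
have [S'E|S'N] := eqVneq (\sum_(j in A :\ i) f j) 0.
  have f'0 j : j \in A :\ i -> f j = 0 by move=> jA; apply: (psumr_eq0P _ S'E).
  rewrite S'E [X in _ + X - _]big1 => [|j jA]; last by rewrite f'0 ?mul0r.
  rewrite [X in _ * (_ * (_ + X) - _)]big1 => [|j jA]; last by rewrite f'0 ?expr0n.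
  rewrite !addr0 subrr add0r => _ _ _.
  have := @bernoulli_kl_ge R n 1 n0 ltac:(lra).
  rewrite ln1 subrr !mul0r mulr0 add0r subr0 add0r mulr1 => B.
  have {}B : g * n%:R <= ln n.+1%:R.
    apply: le_trans B; rewrite -{1}natr1 addrK expr2 mulrA mulfK; last by lra.
    by rewrite ler_wpM2r//; lra.
  rewrite -natr1 (_ : g * _ = f i ^+ 2 * (g * n%:R)); last by ring.
  by rewrite [leRHS]mulrA -expr2 ler_wpM2l ?sqr_ge0// natr1.
move: (f i) a0 S'0 S'N => a a0.
set S' := \sum_(j in _) f j; set Q' := \sum_(j in _) f j ^+ 2.
set H' := \sum_(j in _) _ * ln _ => S'0 S'N CS IH aS.
have {S'0 S'N}S'0 : 0 < S' by rewrite lt_def S'N.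
have S0 : 0 < a + S' by lra.
have {a0}a0 : 0 < a.
  by rewrite lt_def a0 andbT; apply: contraTneq aS => ->; rewrite mulr0; lra.
have E1 : 1 - a / (a + S') = S' / (a + S') by field; lra.
have x01 : 0 <= a / (a + S') <= 1.
  by rewrite divr_ge0 ?ler_pdivrMr ?mul1r /= ?lerDl; lra.
have := bernoulli_kl_ge n0 x01; rewrite E1 !ln_div ?posrE// => B.
have p0 : 0 <= (n.+1%:R * (a / (a + S')) - 1) ^+ 2 / n%:R.
  by rewrite divr_ge0 ?sqr_ge0//; lra.
rewrite -[leLHS]mulrA in B; have {p0}B := le_trans (ler_wpM2r p0 gn) B.
move: aS IH CS B; rewrite -natr1.
move: (n%:R : R) n1 (ln a) (ln S') (ln (a + S')) (ln n%:R) (ln (n%:R + 1)).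
move=> m m1 La L' LS Ln Ln1 aS IH CS B.
have {}B : g * ((m + 1) * a - (a + S')) ^+ 2 / m
    <= (a + S') * (a * La + S' * L' - (a + S') * LS - S' * Ln + (a + S') * Ln1).
  move/(ler_wpM2l (sqr_ge0 (a + S'))) : B.
  rewrite (_ : _ ^+ 2 * (g * _) = g * ((m + 1) * a - (a + S')) ^+ 2 / m); last by field; lra.
  by move/le_trans; apply; rewrite le_eqVlt; apply/orP; left; apply/eqP; field; lra.
have V0 : 0 <= g * (m * Q' - S' ^+ 2) by rewrite mulr_ge0// subr_ge0.
(* The induction hypothesis gets scaled by (a + S')/S', while the target needs (m+1)/m; having
   chosen a coordinate of at least average mass ([aS]) closes this gap. *)
have r : (m + 1) / m <= (a + S') / S'.
  rewrite -subr_ge0.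
  rewrite (_ : _ - _ = ((m + 1) * a - (a + S')) / (m * S')); last by field; lra.
  by rewrite divr_ge0 ?subr_ge0// mulr_ge0; lra.
have {}IH := ler_wpM2l (_ : 0 <= (a + S') / S') IH.
have {IH} := IH ltac:(by rewrite divr_ge0//; lra).
rewrite (_ : _ / _ * (S' * _) = (a + S') * (H' - S' * L' + S' * Ln)); last by field; lra.
have {r V0} := ler_wpM2r V0 r => /le_trans h /h {h} IH.
(* The quadratic side splits like the entropy: a two-point part bounded by [B], and (m+1)/m times
   the deviation of the rest, bounded by [IH]. *)
have -> : g * ((m + 1) * (a ^+ 2 + Q') - (a + S') ^+ 2)
   = g * ((m + 1) * a - (a + S')) ^+ 2 / m + (m + 1) / m * (g * (m * Q' - S' ^+ 2)).
  by field; lra.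
by apply: le_trans (lerD B IH) _; lra.
Qed.

(** * From rows to the matrix *)

Lemma rho_deviation (R : realType) (q k : nat) (M : 'M[R]_(q, k)) :
  (0 < k)%N -> row_stochastic M ->
  \sum_(i < q) \sum_(j < k) (M i j - k%:R^-1) ^+ 2 = rho M - q%:R / k%:R.
Proof.
move=> k0 [_ M1].
have kN0 : k%:R != 0 :> R by rewrite pnatr_eq0 -lt0n.
have rowE i : \sum_(j < k) (M i j - k%:R^-1) ^+ 2
    = \sum_(j < k) M i j ^+ 2 - k%:R^-1.
  under eq_bigr => j _ do rewrite sqrrB.
  rewrite big_split sumrB/= sumr_const card_ord sumrMnl -mulr_suml M1.
  by rewrite -[_ ^+ 2 *+ k]mulr_natl; field.
under eq_bigr => i _ do rewrite rowE.
by rewrite sumrB sumr_const card_ord -[_ *+ q]mulr_natl.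
Qed.

Lemma row_stochastic_entropy_le (R : realType) (q k : nat) (M : 'M[R]_(q, k)) (g : R) :
  0 <= g -> (forall n, (0 < n < k)%N -> g <= kl_const R n) ->
  row_stochastic M ->
  g * (k%:R * rho M - q%:R) <= q%:R * ln k%:R - entropy M.
Proof.
move=> g0 gle [M0 M1].
have rowP i : g * (k%:R * \sum_(j < k) M i j ^+ 2 - 1)
    <= \sum_(j < k) M i j * ln (M i j) + ln k%:R.
  have := @entropy_sum_ge R 'I_k [set: 'I_k] (M i) g g0.
  rewrite cardsT card_ord => /(_ gle (M0 i)) /=.
  have E (F : 'I_k -> R) : \sum_(j in [set: 'I_k]) F j = \sum_j F j.
    by apply: eq_bigl => j; rewrite inE.
  by rewrite !E M1 ln1 mulr0 expr1n subr0 !mul1r.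
have := ler_sum (index_enum 'I_q) (fun i (_ : true) => rowP i).
rewrite -mulr_sumr sumrB -mulr_sumr big_split/= !sumr_const card_ord.
by rewrite /entropy opprK -[ln _ *+ q]mulr_natl [leRHS]addrC.
Qed.

Theorem proposition3p2 (R : realType) (q k : nat) (M : 'M[R]_(q, k)) (c : R)
    (hq : (3 <= q)%N) (hk2 : (2 <= k)%N) (hkq : (k <= q)%N)
    (hM : row_stochastic M)
    (hc : c < (k%:R - 1) / (q%:R - 1) * c_crit R q) :
  let lhs1 := q%:R^-1 * entropy M
    + c * ln (k%:R * q%:R - k%:R - q%:R + k%:R / q%:R * rho M) in
  let rhs1 := ln k%:R + c * ln ((q%:R - 1) * (k%:R - 1)) in
  let lhs2 := c * ln (1 + (k%:R / q%:R * rho M - 1)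
                          / ((q%:R - 1) * (k%:R - 1))) in
  let rhs2 := ln k%:R - q%:R^-1 * entropy M in
  [/\ lhs1 <= rhs1,
      (lhs1 <= rhs1 <-> lhs2 <= rhs2),
      lhs2 <= rhs2,
      (lhs1 = rhs1 <-> forall i j, M i j = k%:R^-1)
    & (lhs2 = rhs2 <-> forall i j, M i j = k%:R^-1)].
Proof.
set X := k%:R / q%:R * rho M - 1; move=> lhs1 rhs1 lhs2 rhs2.
have q3 : (3 : R) <= q%:R by rewrite ler_nat.
have k2 : (2 : R) <= k%:R by rewrite ler_nat.
have k0 : (0 < k)%N by lia.
have dev := rho_deviation k0 hM.
(* As a scaled sum of squares, [X] is nonnegative and vanishes only at the uniform matrix. *)
have XE : X = k%:R / q%:R * \sum_(i < q) \sum_(j < k) (M i j - k%:R^-1) ^+ 2.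
  by rewrite dev /X; field; lra.
have row_dev_ge0 i : 0 <= \sum_(j < k) (M i j - k%:R^-1) ^+ 2.
  by apply: sumr_ge0 => j _; exact: sqr_ge0.
have X0 : 0 <= X by rewrite XE mulr_ge0 ?divr_ge0 ?ler0n ?sumr_ge0.
have XP : X = 0 -> forall i j, M i j = k%:R^-1.
  rewrite XE => /eqP; rewrite mulf_eq0 gt_eqF ?divr_gt0; [|lra..].
  move=> /= /eqP /psumr_eq0P P i j.
  have /psumr_eq0P Pi := P (fun i _ => row_dev_ge0 i) i isT.
  apply/eqP; rewrite -subr_eq0 -sqrf_eq0.
  by rewrite Pi// => ? _; exact: sqr_ge0.
(* Every n < k is at most q - 1, so by antitonicity this one constant serves all support sizes. *)
pose g := kl_const R q.-1.
have rhs2_ge : g * X <= rhs2.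
  have gle n : (0 < n < k)%N -> g <= kl_const R n.
    by move=> /andP[n0 nk]; rewrite kl_const_antitone//; lia.
  have -> : g * X = q%:R^-1 * (g * (k%:R * rho M - q%:R)).
    by rewrite /X; field; lra.
  have -> : rhs2 = q%:R^-1 * (q%:R * ln k%:R - entropy M).
    by rewrite /rhs2; field; lra.
  rewrite ler_pM2l ?invr_gt0; last by lra.
  exact: row_stochastic_entropy_le (kl_const_ge0 R q.-1) gle hM.
pose Y := (q%:R - 1) * (k%:R - 1) : R.
have Y0 : 0 < Y by rewrite mulr_gt0; lra.
(* The threshold on [c] is exactly g Y. *)
have cg : (k%:R - 1) / (q%:R - 1) * c_crit R q = g * Y.
  rewrite /g /kl_const /c_crit leqNgt (_ : (1 < q.-1)%N); last by lia.
  rewrite -subn1 natrB /=; last by lia.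
  by rewrite /Y; field; nra.
rewrite cg in hc.
have lhs2E : lhs2 = c * ln (1 + X / Y) by [].
have XY0 : 0 <= X / Y by rewrite divr_ge0// ltW.
(* Strictness comes from c < g Y times a positive logarithm, whatever the sign of [c]; then ln (1 +
   X/Y) <= X/Y. *)
have lt2 : 0 < X -> lhs2 < rhs2.
  move=> Xpos; apply: lt_le_trans rhs2_ge.
  have XYpos : 0 < X / Y by rewrite divr_gt0.
  have lnpos : 0 < ln (1 + X / Y) by rewrite ln_gt0// ltrDl.
  have -> : g * X = g * Y * (X / Y) by field; lra.
  have gY : 0 <= g * Y by rewrite mulr_ge0 ?kl_const_ge0// ltW.
  rewrite lhs2E; apply: (@lt_le_trans _ _ (g * Y * ln (1 + X / Y))).
    by rewrite ltr_pM2r.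
  by rewrite ler_wpM2l// le_ln1Dx//; lra.
have X_unif : (forall i j, M i j = k%:R^-1) -> X = 0.
  move=> Mu; rewrite XE big1 ?mulr0// => i _; rewrite big1// => j _.
  by rewrite Mu subrr expr0n.
have eq2 : lhs2 = rhs2 <-> forall i j, M i j = k%:R^-1.
  split=> [e|Mu].
    apply: XP; apply/eqP; rewrite eq_le X0 leNgt andbT; apply/negP => /lt2.
    by rewrite e ltxx.
  rewrite lhs2E X_unif// mul0r addr0 ln1 mulr0 /rhs2 /entropy.
  under eq_bigr => i _ do under eq_bigr => j _ do rewrite Mu.
  rewrite !sumr_const !card_ord -[_ * _ *+ k]mulr_natl -[_ * _ *+ q]mulr_natl.
  rewrite lnV ?posrE; last by lra.
  by field; lra.
have le2 : lhs2 <= rhs2.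
  have [Xpos|] := ltP 0 X; first exact/ltW/lt2.
  move=> Xle; suff /eq2 -> : forall i j, M i j = k%:R^-1 by [].
  by apply: XP; apply/eqP; rewrite eq_le Xle.
(* The logarithm in [lhs1] is taken at X + Y = Y (1 + X/Y), so both forms of the inequality have the
   same gap. *)
have shift : lhs1 - rhs1 = lhs2 - rhs2.
  have -> : lhs1 = q%:R^-1 * entropy M + c * (ln Y + ln (1 + X / Y)).
    rewrite /lhs1 -lnM ?posrE; [|lra..].
    by congr (_ + c * ln _); rewrite /X /Y; field; nra.
  by rewrite /rhs1 lhs2E /rhs2 -/Y; ring.
have le12 : (lhs1 <= rhs1) = (lhs2 <= rhs2) by rewrite -subr_le0 shift subr_le0.
have eq12 : lhs1 = rhs1 <-> lhs2 = rhs2 by split; lra.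
by split; rewrite ?le12// eq12.
Qed.
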